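(* Let $R_{int}(\boldsymbol{x},t;\theta)$ be the interior PDE residual of a neural network with parameters $\theta$, let $(\boldsymbol{x}_{int}^{(i)},t_{int}^{(i)})$, $i=1,\dots,M_{int}$, be fixed interior collocation points, and let $\mathcal{L}(\theta)$ be the loss function. Assume: (A1) $\mathcal{L}$ is continuously differentiable in $\theta$ and there is $L_g>0$ with $\|\nabla_\theta\mathcal{L}(\theta_1)-\nabla_\theta\mathcal{L}(\theta_2)\|\le L_g\|\theta_1-\theta_2\|$ for all $\theta_1,\theta_2$; (A2) the optimization algorithm produces a sequence of parameters $\{\theta^k\}_{k\ge1}$ converging to a stationary point $\theta^*$, i.e. $\lim_{k\to\infty}\theta^k=\theta^*$ and $\nabla_\theta\mathcal{L}(\theta^* )=0$; (A3) $R_{int}(\boldsymbol{x},t;\theta)$ is continuous in $\theta$ for all $(\boldsymbol{x},t)\in D\times[0,T]$. Let $\beta\in(0,1)$ and let the weight vectors $\boldsymbol{\lambda}_{int}^k\in\mathbb{R}^{M_{int}}$ be defined from an initial vector $\boldsymbol{\lambda}_{int}^0$ by $$\boldsymbol{\lambda}^{k}_{int}=\beta\,\boldsymbol{\lambda}_{Knear,r}^k+(1-\beta)\,\boldsymbol{\lambda}^{k-1}_{int},\qquad k\ge 1,$$ where $\boldsymbol{\lambda}_{Knear,r}^k$ is the vector of neighbor-averaged normalized residual weights at parameter $\theta^k$ (defined in the context). Then the weights converge: there is a vector $\boldsymbol{\lambda}^*$ with $$\lim_{k\to\infty}\boldsymbol{\lambda}_{int}^k=\boldsymbol{\lambda}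^*.$$
   Context: $D\subset\mathbb{R}^d$ is an open bounded domain and $T>0$. For a PDE $u_t=\mathcal{S}(u)$ on $D\times[0,T]$ and a neural network $u(\cdot;\theta)$, the interior residual is $R_{int}(\boldsymbol{x},t;\theta)=u_t(\boldsymbol{x},t;\theta)-\mathcal{S}(u(\boldsymbol{x},t;\theta))$. The pointwise normalized weights are $$w_{int}(\boldsymbol{x}_{int}^{(i)},t_{int}^{(i)};\theta)=\frac{|R_{int}(\boldsymbol{x}_{int}^{(i)},t_{int}^{(i)};\theta)|}{\sum_{l=1}^{M_{int}}|R_{int}(\boldsymbol{x}_{int}^{(l)},t_{int}^{(l)};\theta)|}\cdot M_{int},\qquad i=1,\dots,M_{int}.$$ For each $i$, $\boldsymbol{S}_{k_{int}}^{(i)}$ is a fixed set of $k_{int}$ collocation points near $(\boldsymbol{x}_{int}^{(i)},t_{int}^{(i)})$ ($k_{int}$ nearest points). Set $$\lambda_{Knear,r}^{(i)}(\theta)=\frac{1}{k_{int}}\sum_{(\boldsymbol{x}_{int}^{(j)},t_{int}^{(j)})\in\boldsymbol{S}_{k_{int}}^{(i)}}w_{int}(\boldsymbol{x}_{int}^{(j)},t_{int}^{(j)};\theta),\qquad \boldsymbol{\lambda}_{Knear,r}^k=\bigl(\lambda_{Knear,r}^{(1)}(\theta^k),\dots,\lambda_{Knear,r}^{(M_{int})}(\theta^k)\bigr)^\top.$$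
   Formalization: The formal theorem additionally assumes that the sum of the absolute residuals over the collocation points is nonzero at the limit θ*; without this the normalized weights can oscillate as θ^k tends to θ* and the claim fails. *)

(* Defs.v *)
From HB Require Import structures.
From mathcomp Require Import all_boot all_order all_algebra.
From mathcomp Require Import all_classical all_reals all_analysis.

Set Implicit Arguments.
Unset Strict Implicit.
Unset Printing Implicit Defensive.

Import Order.TTheory GRing.Theory Num.Theory.
Import numFieldNormedType.Exports.

Local Open Scope classical_set_scope.
Local Open Scope ring_scope.

(* The library norm on ['rV[R]_n] is the sup norm; this is the Euclidean one. *)
Definition enorm (R : realType) (n : nat) (v : 'rV[R]_n) : R :=
  Num.sqrt (\sum_(i < n) v 0 i ^+ 2).

Definition gradient (R : realType) (p : nat) (L : 'rV[R]_p -> R)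
    (theta : 'rV[R]_p) : 'rV[R]_p :=
  \row_(i < p) 'D_(delta_mx 0 i) L theta.

Definition continuously_differentiable (R : realType) (p : nat)
    (L : 'rV[R]_p -> R) : Prop :=
  (forall theta, differentiable L theta) /\ continuous (gradient L).

Section Residual.
Variables (R : realType) (d p : nat).

(* Functions of (x, t). [calS] acts on whole functions, so it may be any,
   possibly nonlinear or nonlocal, (differential) operator. *)
Variable calS : ('rV[R]_d -> R -> R) -> ('rV[R]_d -> R -> R).

(* [u x t theta] is the network output. The derivative in [t] is two-sided,
   also at the ends of [0, T]: a network is defined for every real t. *)
Variable u : 'rV[R]_d -> R -> 'rV[R]_p -> R.

Definition R_int (x : 'rV[R]_d) (t : R) (theta : 'rV[R]_p) : R :=
  derive1 (fun s => u x s theta) t - calS (fun y s => u y s theta) x t.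

Variables (M : nat) (X : 'I_M -> 'rV[R]_d) (t : 'I_M -> R).

Definition residual_sum (theta : 'rV[R]_p) : R :=
  \sum_(l < M) `|R_int (X l) (t l) theta|.

Definition w_int (theta : 'rV[R]_p) (i : 'I_M) : R :=
  `|R_int (X i) (t i) theta| / residual_sum theta * M%:R.

Definition lambda_Knear (k : nat) (S : 'I_M -> {set 'I_M})
    (theta : 'rV[R]_p) : 'cV[R]_M :=
  \col_(i < M) (k%:R^-1 * \sum_(j in S i) w_int theta j).

End Residual.

Section Neighbours.
Variables (R : realType) (d M : nat) (X : 'I_M -> 'rV[R]_d) (t : 'I_M -> R).

Definition spacetime_dist (i j : 'I_M) : R :=
  Num.sqrt (enorm (X i - X j) ^+ 2 + (t i - t j) ^+ 2).

(* [A] is a set of (indices of) k collocation points nearest to point i. Ties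
   are broken arbitrarily, and the clause [l != i] admits both conventions:
   point i counted among its own neighbours, or left out. *)
Definition k_nearest (k : nat) (i : 'I_M) (A : {set 'I_M}) : Prop :=
  #|A| = k /\
  forall j l, j \in A -> l \notin A -> l != i ->
    spacetime_dist i j <= spacetime_dist i l.

End Neighbours.

(* Main.v *)
Require Import Defs.
From HB Require Import structures.
From mathcomp Require Import all_boot all_order all_algebra.
From mathcomp Require Import all_classical all_reals all_analysis.
From mathcomp Require Import lra.

(** The weight recursion is an exponential moving average: a relaxation with
    factor [1 - beta], of modulus less than 1, driven by the averaged residual
    weights at the current parameters.  Such a recursion forgets its initial
    value geometrically fast, so it converges to the limit of its driving
    sequence as soon as that limit exists ([cvg_moving_average], which rests on
    the scalar estimate [cvg_perturbed_contraction]).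

    The driving sequence converges because the averaged weights are a continuous
    function of the parameters at the limit point [thetas]
    ([cvg_lambda_Knear]): they are built from finitely many continuous residuals
    by absolute values, sums and one division, whose denominator, the total
    residual, does not vanish at [thetas].  Hence the limit of the weight vectors
    is the averaged weight vector at [thetas]. *)

Set Implicit Arguments.
Unset Strict Implicit.
Unset Printing Implicit Defensive.

Import Order.TTheory GRing.Theory Num.Theory.
Import numFieldNormedType.Exports.

Local Open Scope classical_set_scope.
Local Open Scope ring_scope.

(** Once [c] stays below [(1 - r) * eps / 2], the value [eps / 2] is stable under
    one step of the recursion, and the excess of [e] over it is multiplied by at
    most [r] at each step. *)
Lemma cvg_perturbed_contraction (R : realType) (r : R) (c e : nat -> R) :
  0 <= r -> r < 1 -> (forall n, 0 <= e n) ->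
  (forall n, e n.+1 <= r * e n + c n) ->
  c @ \oo --> 0 -> e @ \oo --> 0.
Proof.
move=> r0 r1 e0 e_rec c_cvg; apply/cvgrPdist_le => eps eps0.
have d0 : 0 < (1 - r) * (eps / 2) by rewrite mulr_gt0 ?subr_gt0 ?divr_gt0.
have [N _ c_small] : \forall n \near \oo, `|0 - c n| <= (1 - r) * (eps / 2).
  by move/cvgrPdist_le : c_cvg; exact.
have e_geom m : e (m + N)%N <= r ^+ m * e N + eps / 2.
  elim: m => [|m IHm]; first by rewrite add0n expr0 mul1r lerDl divr_ge0 ?ltW.
  apply: (le_trans (e_rec _)).
  have c_le : c (m + N)%N <= (1 - r) * (eps / 2).
    have := c_small (m + N)%N (leq_addl _ _).
    by rewrite sub0r normrN; apply: le_trans; exact: ler_norm.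
  apply: (le_trans (lerD (ler_wpM2l r0 IHm) c_le)).
  by rewrite exprS; lra.
have [N' _ geom_small] :
    \forall m \near \oo, `|0 - geometric (e N) r m| <= eps / 2.
  have : geometric (e N) r @ \oo --> 0 by apply: cvg_geometric; rewrite ger0_norm.
  by move/cvgrPdist_le; apply; rewrite divr_gt0.
exists (N' + N)%N => // n /= Nn.
have /subnK <- : (N <= n)%N by apply: leq_trans Nn; exact: leq_addl.
rewrite sub0r normrN ger0_norm//; apply: (le_trans (e_geom _)).
have N'n : (N' <= n - N)%N by rewrite leq_subRL ?(leq_trans _ Nn) ?leq_addl// addnC.
have := geom_small _ N'n; rewrite sub0r normrN /=.
by move/(le_trans (ler_norm _)); rewrite mulrC; lra.
Qed.

(** With constant input [l] the recursion fixes [l], so the distance to [l] satisfies a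
    contraction perturbed by the distance from the driving sequence to [l]. *)
Lemma cvg_moving_average (R : realType) (V : normedModType R) (beta : R)
    (a x : nat -> V) (l : V) :
  `|1 - beta| < 1 ->
  (forall n, x n.+1 = beta *: a n + (1 - beta) *: x n) ->
  a @ \oo --> l -> x @ \oo --> l.
Proof.
move=> q1 x_rec a_cvg.
have dist_cvg : (fun n => `|x n - l|) @ \oo --> 0.
  apply: (@cvg_perturbed_contraction _ _ (fun n => `|beta| * `|a n - l|)
    _ _ q1) => // [n|].
    have -> : x n.+1 - l = (1 - beta) *: (x n - l) + beta *: (a n - l).
      rewrite x_rec !scalerBr addrACA -opprD -scalerDl subrK scale1r.
      by congr (_ - _); rewrite addrC.
    by apply: (le_trans (ler_normD _ _)); rewrite !normrZ.
  rewrite -(mulr0 `|beta|); apply: cvgMl_tmp.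
  by rewrite -(@normr0 _ V); apply: cvg_norm; apply/subr_cvg0.
by apply/subr_cvg0; apply/norm_cvg0P.
Qed.

Lemma cvg_mx_entries (T : topologicalType) (m n : nat) (I : Type)
    (F : set_system I) (f : I -> 'M[T]_(m, n)) (l : 'M[T]_(m, n)) :
  Filter F -> (forall i j, f x i j @[x --> F] --> l i j) -> f @ F --> l.
Proof.
move=> FF f_cvg A [P l_P sPA].
have P_f : \forall x \near F, forall i j, P i j (f x i j).
  by do 2!apply: filter_forall => ?; exact: f_cvg.
by apply: filterS P_f => x Pfx; apply: sPA.
Qed.

Section Weights.
Variables (R : realType) (d p : nat).
Variable calS : ('rV[R]_d -> R -> R) -> ('rV[R]_d -> R -> R).
Variable u : 'rV[R]_d -> R -> 'rV[R]_p -> R.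
Variables (M : nat) (X : 'I_M -> 'rV[R]_d) (t : 'I_M -> R).
Variables (theta : nat -> 'rV[R]_p) (thetas : 'rV[R]_p).
Hypothesis theta_cvg : theta @ \oo --> thetas.
Hypothesis R_cont : forall i, {for thetas, continuous (R_int calS u (X i) (t i))}.
Hypothesis residual_neq0 : residual_sum calS u X t thetas != 0.

Lemma cvg_abs_residual i :
  `|R_int calS u (X i) (t i) (theta k)| @[k --> \oo]
    --> `|R_int calS u (X i) (t i) thetas|.
Proof.
apply: cvg_norm.
exact: (cvg_comp _ _ theta_cvg (@R_cont i)).
Qed.

Lemma cvg_w_int i :
  w_int calS u X t (theta k) i @[k --> \oo] --> w_int calS u X t thetas i.
Proof.
rewrite /w_int; apply: cvgM; last exact: cvg_cst.
apply: cvgM; first exact: cvg_abs_residual.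
apply: cvgV => //; rewrite /residual_sum.
by apply: cvg_big => [|j _]; [exact: add_continuous|exact: cvg_abs_residual].
Qed.

Lemma cvg_lambda_Knear k (S : 'I_M -> {set 'I_M}) :
  lambda_Knear calS u X t k S (theta n) @[n --> \oo]
    --> lambda_Knear calS u X t k S thetas.
Proof.
apply: cvg_mx_entries => i j.
under eq_cvg do rewrite mxE.
rewrite mxE; apply: cvgMl_tmp.
by apply: cvg_big => [|l _]; [exact: add_continuous|exact: cvg_w_int].
Qed.

End Weights.

Theorem theorem2p1 (R : realType) (d p : nat)
    (* the space-time domain *)
    (D : set 'rV[R]_d) (T : R)
    (D_open : open D) (D_bounded : bounded_set D)
    (D_connected : connected D) (D_nonempty : D !=set0) (T_gt0 : 0 < T)
    (* the PDE and the network *)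
    (calS : ('rV[R]_d -> R -> R) -> ('rV[R]_d -> R -> R))
    (u : 'rV[R]_d -> R -> 'rV[R]_p -> R)
    (* the collocation points and their neighbour sets *)
    (M : nat) (X : 'I_M -> 'rV[R]_d) (t : 'I_M -> R)
    (X_in : forall i, X i \in D) (t_in : forall i, 0 <= t i <= T)
    (k_int : nat) (k_gt0 : (0 < k_int)%N)
    (S : 'I_M -> {set 'I_M}) (S_near : forall i, k_nearest X t k_int i (S i))
    (* the loss: (A1) *)
    (L : 'rV[R]_p -> R)
    (L_C1 : continuously_differentiable L)
    (L_lip : exists2 Lg : R, 0 < Lg & forall theta1 theta2,
      enorm (gradient L theta1 - gradient L theta2)
        <= Lg * enorm (theta1 - theta2))
    (* the parameter sequence: (A2) *)
    (theta : nat -> 'rV[R]_p) (thetas : 'rV[R]_p)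
    (theta_cvg : theta @ \oo --> thetas)
    (theta_stat : gradient L thetas = 0)
    (* (A3) *)
    (R_cont : forall x s, x \in D -> 0 <= s <= T ->
      continuous (R_int calS u x s))
    (* the normalized weights are defined at the limit point *)
    (residual_neq0 : residual_sum calS u X t thetas != 0)
    (* the weight vectors *)
    (beta : R) (beta_gt0 : 0 < beta) (beta_lt1 : beta < 1)
    (lambda : nat -> 'cV[R]_M)
    (lambda_rec : forall k, (1 <= k)%N ->
      lambda k = beta *: lambda_Knear calS u X t k_int S (theta k)
                 + (1 - beta) *: lambda k.-1) :
  exists lambdas : 'cV[R]_M, lambda @ \oo --> lambdas.
Proof.
exists (lambda_Knear calS u X t k_int S thetas).
apply: (@cvg_moving_average _ _ beta
  (fun n => lambda_Knear calS u X t k_int S (theta n.+1))).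
- by rewrite ger0_norm; lra.
- by move=> n; rewrite lambda_rec.
- apply: (@cvg_lambda_Knear _ _ _ _ _ _ _ _ (fun n => theta n.+1)) => //.
    by rewrite cvg_shiftS.
  by move=> i; apply: R_cont.
Qed.
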